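(* Let $\Omega\subset\mathbb{R}^d$ be compact and convex, let $m\ge2$, let $\mu_1,\dots,\mu_m\in\mathcal{P}_2(\Omega)$, and let $\alpha_1,\dots,\alpha_m>0$ with $\sum_{i=1}^m\alpha_i=1$. For continuous functions $f_1,\dots,f_{m-1}$ on $\Omega$ define $$\mathcal{D}(f_1,\dots,f_{m-1})=\sum_{i=1}^{m-1}\alpha_i\int_\Omega f_i^c\,d\mu_i+\alpha_m\int_\Omega f_{\mathrm{mix}}^c\,d\mu_m,\qquad f_{\mathrm{mix}}=-\sum_{i=1}^{m-1}\frac{\alpha_i}{\alpha_m}f_i.$$ Then the mapping $(f_1,\dots,f_{m-1})\mapsto\mathcal{D}(f_1,\dots,f_{m-1})$ is jointly concave.
   Context: $\mathcal{P}_2(\Omega)$ is the set of probability measures on $\Omega$ with finite second moment. The $c$-transform of $f:\Omega\to\mathbb{R}$ is $f^c(x)=\inf_{y\in\Omega}\{\frac12\|x-y\|_2^2-f(y)\}$. *)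

(* Defs.v *)
From HB Require Import structures.
From mathcomp Require Import all_boot all_order all_algebra.
From mathcomp Require Import all_classical all_reals all_analysis.

Set Implicit Arguments.
Unset Strict Implicit.
Unset Printing Implicit Defensive.

Import Order.TTheory GRing.Theory Num.Theory.
Import numFieldNormedType.Exports.

Local Open Scope classical_set_scope.
Local Open Scope ring_scope.
Local Open Scope convex_scope.

Notation borelRn R d := (g_sigma_algebraType (@open 'rV[R]_d)).

(* The library norm on ['rV[R]_d] is the sup norm (same topology). *)
Definition l2norm (R : realType) (d : nat) (x : 'rV[R]_d) : R :=
  Num.sqrt (\sum_(k < d) x ord0 k ^+ 2).

(* A probability measure on [Omega] is represented as a Borel probability
   measure on R^d that gives full mass to [Omega]. *)
Definition P2 (R : realType) (d : nat) (Omega : set 'rV[R]_d)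
    (mu : probability (borelRn R d) R) : Prop :=
  mu Omega = 1%E /\ (\int[mu]_(x in Omega) (l2norm x ^+ 2)%:E < +oo)%E.

(* [inf] is the real infimum, which is the true one when [f] is bounded above
   on a nonempty [Omega], e.g. for [f] continuous and [Omega] compact.  Only
   the values of [f] on [Omega] matter. *)
Definition c_transform (R : realType) (d : nat) (Omega : set 'rV[R]_d)
    (f : 'rV[R]_d -> R^o) (x : 'rV[R]_d) : R :=
  inf [set 2^-1 * l2norm (x - y) ^+ 2 - f y | y in Omega].

Section dual_functional.
Context (R : realType) (d n : nat) (Omega : set 'rV[R]_d).
Context (mu : 'I_n.+1 -> probability (borelRn R d) R) (alpha : 'I_n.+1 -> R).

(* With m = n + 1 measures, the index m is [ord_max : 'I_n.+1], and [inc]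
   embeds the indices of the potentials f_1, ..., f_(m-1). *)
Let inc (i : 'I_n) : 'I_n.+1 := widen_ord (leqnSn n) i.

Definition f_mix (f : 'I_n -> 'rV[R]_d -> R^o) (x : 'rV[R]_d) : R :=
  - \sum_(i < n) alpha (inc i) / alpha ord_max * f i x.

Definition dual_functional (f : 'I_n -> 'rV[R]_d -> R^o) : R :=
  \sum_(i < n) alpha (inc i) *
    (\int[mu (inc i)]_(x in Omega) c_transform Omega (f i) x)
  + alpha ord_max *
    (\int[mu ord_max]_(x in Omega) c_transform Omega (f_mix f) x).

End dual_functional.

Definition continuous_tuples (R : realType) (d n : nat)
    (Omega : set 'rV[R]_d) : set ('I_n -> 'rV[R]_d -> R^o) :=
  [set f | forall i, {within Omega, continuous (f i)}].

(* Mirrors [convex_function]. *)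
Definition concave_function (R : numFieldType) (E : lmodType R)
    (E' := convex_lmodType E) (D : set E') (f : E' -> R^o) :=
  forall t : {i01 R},
    {in D &, forall x y : E', f x <| t |> f y <= f (x <| t |> y)}.

(* Main.v *)
(* For fixed x, the c-transform of f at x is an infimum of functions that are
   affine in f, hence concave in f; f_mix is linear in the potentials, and
   integration against the mu_i preserves concavity.  The real-valued integral
   is additive and monotone only on integrable functions, and c-transforms are
   integrable because they are upper semicontinuous and bounded on Omega. *)

Require Import Defs.
From mathcomp Require Import all_boot all_order all_algebra.
From mathcomp Require Import all_classical all_reals all_analysis.
From mathcomp Require Import measurable_realfun ring lra.
Import Order.TTheory GRing.Theory Num.Theory.
Import numFieldNormedType.Exports.
Set Implicit Arguments.
Unset Strict Implicit.
Local Open Scope classical_set_scope.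
Local Open Scope ring_scope.

Lemma continuous_l2norm_sqr (R : realType) (d : nat) :
  continuous (fun x : 'rV[R]_d => l2norm x ^+ 2 : R).
Proof.
have -> : (fun x : 'rV[R]_d => l2norm x ^+ 2 : R) =
    (fun x => \sum_(k < d) x ord0 k ^+ 2).
  apply/funext => x; rewrite sqr_sqrtr//.
  by apply: sumr_ge0 => k _; exact: sqr_ge0.
apply: continuous_big => [|k _ x]; first exact: add_continuous.
have cx := @coord_continuous R 1 d ord0 k x.
exact: (cvgM cx cx).
Qed.

Lemma continuous_cost (R : realType) (d : nat) (y : 'rV[R]_d) :
  continuous (fun x : 'rV[R]_d => 2^-1 * l2norm (x - y) ^+ 2 : R).
Proof.
move=> x; have cB : {for x, continuous (fun z : 'rV[R]_d => z - y)}.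
  exact: (cvgB cvg_id (cvg_cst y)).
have cN := continuous_comp cB (@continuous_l2norm_sqr R d _).
exact: (cvgMl_tmp cN).
Qed.

Lemma cost_ge0 (R : realType) (d : nat) (x : 'rV[R]_d) :
  0 <= 2^-1 * l2norm x ^+ 2.
Proof. by rewrite mulr_ge0// ?invr_ge0// sqr_ge0. Qed.

Lemma compact_within_bounded (R : realType) (T : topologicalType) (A : set T)
    (f : T -> R) : compact A -> {within A, continuous f} ->
  exists M, forall x, A x -> `|f x| <= M.
Proof.
move=> cA cf; have /compact_bounded/ex_strict_bound_gt0[M _ Mf] := continuous_compact cf cA.
by exists M => x Ax; apply/ltW/Mf; exists x.
Qed.

Lemma measurable_open_borelRn (R : realType) (d : nat)
    (A : set 'rV[R]_d) : open A -> measurable (A : set (borelRn R d)).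
Proof. by move=> oA; exact: sub_sigma_algebra. Qed.

Lemma measurable_compact_borelRn (R : realType) (d : nat)
    (A : set 'rV[R]_d) : compact A -> measurable (A : set (borelRn R d)).
Proof.
move=> cA; rewrite -(setCK A); apply: measurableC.
apply: measurable_open_borelRn; apply: closed_openC.
by apply: compact_closed cA; exact: norm_hausdorff.
Qed.

Section c_transform.
Context (R : realType) (d : nat) (Omega : set 'rV[R]_d).
Hypothesis Omega_compact : compact Omega.
Hypothesis Omega_nonempty : Omega !=set0.
Implicit Types f g : 'rV[R]_d -> R^o.

(** The real [inf] is a lower bound only of a set that is bounded below. Since the cost is
    nonnegative and [f] is bounded on the compact [Omega] by some [M], the number [- M] is such a
    bound. *)
Lemma c_transform_le f x y : {within Omega, continuous f} -> Omega y ->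
  c_transform Omega f x <= 2^-1 * l2norm (x - y) ^+ 2 - f y.
Proof.
move=> cf Oy; have [M Mf] := compact_within_bounded Omega_compact cf.
apply: ge_inf; last by exists y.
exists (- M) => _ [z Oz <-].
rewrite -[leLHS]add0r lerD ?cost_ge0// lerN2.
exact: le_trans (ler_norm _) (Mf _ Oz).
Qed.

(** This direction rests on [Omega] being nonempty: the real [inf] of the empty set is the default
    value 0. *)
Lemma le_c_transform f x a :
  (forall y, Omega y -> a <= 2^-1 * l2norm (x - y) ^+ 2 - f y) ->
  a <= c_transform Omega f x.
Proof.
move=> af; apply: lb_le_inf; last by move=> _ [y Oy <-]; exact: af.
by have [y Oy] := Omega_nonempty; exists (2^-1 * l2norm (x - y) ^+ 2 - f y), y.
Qed.

Lemma concave_c_transform f g (t : {i01 R}) x :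
    {within Omega, continuous f} -> {within Omega, continuous g} ->
  t%:num * c_transform Omega f x + (1 - t%:num) * c_transform Omega g x <=
  c_transform Omega (fun y => t%:num * f y + (1 - t%:num) * g y) x.
Proof.
move=> cf cg; apply: le_c_transform => y Oy.
set c := 2^-1 * _.
(* The weights sum to 1, so the cost [c] can be shared between the two potentials. *)
have -> : c - (t%:num * f y + (1 - t%:num) * g y) =
    t%:num * (c - f y) + (1 - t%:num) * (c - g y).
  by ring.
by apply: lerD; apply: ler_wpM2l => //; rewrite ?subr_ge0//;
  exact: c_transform_le.
Qed.

(** Upper semicontinuity: an infimum lies below [a] exactly when some member does, so the strict
    sublevel set is a union of open sublevel sets of continuous functions, one for each [y] in
    [Omega]. *)
Lemma open_c_transform_lt f a : {within Omega, continuous f} ->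
  open [set x | c_transform Omega f x < a].
Proof.
move=> cf.
have -> : [set x | c_transform Omega f x < a] =
    \bigcup_(y in Omega) [set x | 2^-1 * l2norm (x - y) ^+ 2 - f y < a].
  apply/seteqP; split=> [x /inf_lt|x [y Oy]]; last exact/le_lt_trans/c_transform_le.
  case; last by move=> _ [y Oy <-] ya; exists y.
  by have [y Oy] := Omega_nonempty; exists (2^-1 * l2norm (x - y) ^+ 2 - f y), y.
apply: bigcup_open => y _.
have := @open_comp _ _ (fun x : 'rV[R]_d => 2^-1 * l2norm (x - y) ^+ 2 - f y : R)
  [set z | z < a].
apply; last exact: open_lt.
by move=> x _; exact: (cvgB (@continuous_cost R d y x) (cvg_cst (f y))).
Qed.

Lemma measurable_c_transform f : {within Omega, continuous f} ->
  measurable_fun setT (c_transform Omega f : borelRn R d -> R).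
(* The open rays unbounded below generate the Borel sets of the line, so open strict sublevel sets
   suffice. *)
Proof.
move=> cf; apply: (measurability _ (RGenInftyO.measurableE R)).
move=> _ [_ [a ->] <-]; rewrite setTI preimage_itvNyo.
by apply: measurable_open_borelRn; exact: open_c_transform_lt.
Qed.

Lemma bounded_c_transform f : {within Omega, continuous f} ->
  [bounded c_transform Omega f x | x in Omega].
Proof.
move=> cf; have [M Mf] := compact_within_bounded Omega_compact cf.
have [y Oy] := Omega_nonempty.
have [N Nc] := compact_within_bounded Omega_compact
  (continuous_subspaceT (@continuous_cost R d y)).
apply/(@ex_bound _ _ _ _ _ (globally_properfilter Oy)).
(* [M] bounds [f], and [N] bounds the cost of reaching the fixed point [y]. Testing the infimum at
   [y] gives the upper bound; nonnegativity of the cost gives the lower bound [- M], which [0 <= N]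
   weakens to [- (N + M)]. *)
exists (N + M) => x Ox /=.
have N0 : 0 <= N by exact: le_trans (Nc _ Oy).
rewrite ler_norml; apply/andP; split.
  apply: le_c_transform => z Oz.
  have := Mf _ Oz; rewrite ler_norml => /andP[_ fM].
  by have := cost_ge0 (x - z); lra.
apply: le_trans (c_transform_le x cf Oy) _.
have := Mf _ Oy; rewrite ler_norml => /andP[fM _].
by have := Nc _ Ox; rewrite ler_norml => /andP[_ cN]; lra.
Qed.

Lemma integrable_c_transform (mu : probability (borelRn R d) R) f :
    {within Omega, continuous f} ->
  mu.-integrable Omega (EFin \o c_transform Omega f).
Proof.
move=> cf; apply: measurable_bounded_integrable.
- exact: measurable_compact_borelRn.
- rewrite ltey_eq fin_num_measure//.
  exact: measurable_compact_borelRn.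
- exact: measurable_funTS (measurable_c_transform cf).
- exact: bounded_c_transform.
Qed.

Lemma concave_integral_c_transform (mu : probability (borelRn R d) R) f g
    (t : {i01 R}) :
    {within Omega, continuous f} -> {within Omega, continuous g} ->
  t%:num * (\int[mu]_(x in Omega) c_transform Omega f x) +
    (1 - t%:num) * (\int[mu]_(x in Omega) c_transform Omega g x) <=
  \int[mu]_(x in Omega)
    c_transform Omega (fun y => t%:num * f y + (1 - t%:num) * g y) x.
Proof.
move=> cf cg.
have mO := measurable_compact_borelRn Omega_compact.
have intf := integrable_c_transform mu cf.
have intg := integrable_c_transform mu cg.
have intZ (a : R) h : mu.-integrable Omega (EFin \o h) ->
    mu.-integrable Omega (EFin \o (fun x => a * h x)).
  by move=> ih; exact: (integrableZl mO a ih).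
rewrite -!RintegralZl// -RintegralD//; [|exact: intZ..].
apply: le_Rintegral => //.
- exact: (integrableD mO (intZ _ _ intf) (intZ _ _ intg)).
(* The combined potential is again continuous on [Omega], so its c-transform is integrable too. *)
- apply: integrable_c_transform => x; apply: cvgD.
    by apply: cvgMl_tmp; exact: cf.
  by apply: cvgMl_tmp; exact: cg.
- by move=> x _; exact: concave_c_transform.
Qed.

End c_transform.

Lemma continuous_f_mix (R : realType) (d n : nat) (Omega : set 'rV[R]_d)
    (alpha : 'I_n.+1 -> R) (f : 'I_n -> 'rV[R]_d -> R^o) :
  continuous_tuples Omega f -> {within Omega, continuous (f_mix alpha f)}.
Proof.
move=> cf x; apply: cvgN.
apply: (@continuous_big R^o) x => [|i _ x]; first exact: add_continuous.
by apply: cvgMl_tmp; exact: cf.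
Qed.

(** Linearity of [f_mix] turns the last term of the dual functional into an instance of the
    one-potential inequality. The left side uses the module operations on tuples, to which the
    convex combination in the goal unfolds. *)
Lemma f_mix_comb (R : realType) (d n : nat) (alpha : 'I_n.+1 -> R)
    (f g : 'I_n -> 'rV[R]_d -> R^o) (a b : R) :
  f_mix alpha (a *: f + b *: g) =
  (fun y => a * f_mix alpha f y + b * f_mix alpha g y).
Proof.
apply/funext => y; rewrite /f_mix !mulrN -opprD; congr (- _).
rewrite !mulr_sumr -big_split; apply: eq_bigr => i _ /=.
rewrite -[(_ + _) i y]/(a * f i y + b * g i y); ring.
Qed.

Theorem lemma3 (R : realType) (d n : nat) (Omega : set 'rV[R]_d)
    (mu : 'I_n.+1 -> probability (borelRn R d) R) (alpha : 'I_n.+1 -> R)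
    (Omega_compact : compact Omega)
    (Omega_convex : convex_set Omega)
    (m_ge2 : (2 <= n.+1)%N)
    (mu_P2 : forall i, P2 Omega (mu i))
    (alpha_gt0 : forall i, 0 < alpha i)
    (alpha_sum1 : \sum_(i < n.+1) alpha i = 1) :
  concave_function (continuous_tuples Omega) (dual_functional Omega mu alpha).
Proof.
(* An empty [Omega] would have measure 0, against the full mass 1 given by [P2]. *)
have Omega0 : Omega !=set0.
  apply/set0P/eqP => O0; have [+ _] := mu_P2 ord0.
  by rewrite O0 measure0 => /eqP; rewrite eqe eq_sym oner_eq0.
move=> t f g /set_mem cf /set_mem cg.
(* Regrouping separates the first [n] terms from the [f_mix] term, so that each can be compared on
   its own; the positive weights then cancel. *)
rewrite convRE /dual_functional !mulrDr addrACA; apply: lerD.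
  rewrite !mulr_sumr -big_split; apply: ler_sum => i _ /=.
  rewrite !(mulrCA _ (alpha _)) -mulrDr ler_pM2l//.
  exact: (concave_integral_c_transform Omega_compact Omega0 _ t (cf i) (cg i)).
rewrite !(mulrCA _ (alpha _)) -mulrDr ler_pM2l// f_mix_comb.
by apply: concave_integral_c_transform => //; exact: continuous_f_mix.
Qed.
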